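(* For any FRACTRAN program $Q$ and any $f:(\mathbb N\to\mathbb N)\to\mathbb N$, one can compute a map which, given a Diophantine witness for $f$, produces a Diophantine witness for the relation $\nu\mapsto\bigl(Q\text{ terminates from }f\nu\bigr)$.
   Context: A FRACTRAN program is a list of pairs $(p,q)\in\mathbb N^2$, written $p/q$. The step relation $Q:x\succ y$ is defined inductively. - $(p/q::Q'):x\succ y$ if $qy=px$. - $(p/q::Q'):x\succ y$ if $q\nmid px$ and $Q':x\succ y$. $Q$ terminates from $s$ if there is $x$ reachable from $s$ by finitely many steps such that there is no $y$ with $Q:x\succ y$. Diophantine logic formulas are $A,B::= x_i\doteq n\mid x_i\doteq x_j\mid x_i\doteq x_j\dot+x_k\mid x_i\doteq x_j\dot\times x_k\mid A\dot\wedge B\mid A\dot\vee B\mid\dot\exists A$ (De Bruijn indices). For a valuation $\nu:\mathbb N\to\mathbb N$ the semantics is as follows. - Atoms have their obvious meaning. - $\dot\wedge$ and $\dot\vee$ are interpreted as $\wedge$ and $\vee$. - $[\![\dot\exists A]\!]\nu\iff\exists n,\ [\![A]\!](n\cdot\nu)$, with $(n\cdot\nu)(0)=n$ and $(n\cdot\nu)(i+1)=\nu(i)$. A Diophantine witness for a relation $S$ on valuations is a formula $A$ with $[\![A]\!]\nu\leftrightarrow S\,\nu$ for all $\nu$. A Diophantine witness for $f:(\mathbb N\to\mathbb N)\to\mathbb N$ is one for the relation $\nu\mapsto\nu(0)=f(\uparrow\nu)$, where $(\uparrow\nu)(i)=\nu(i+1)$. *)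

(* Defs.v *)
From Stdlib Require Import Arith List Relations.
Import ListNotations.

(** * FRACTRAN *)

(** The pair [(p, q)] stands for the fraction [p/q]; [q = 0] is allowed. *)
Definition fractran_program := list (nat * nat).

Inductive fractran_step : fractran_program -> nat -> nat -> Prop :=
  | fractran_step_head (p q : nat) (Q : fractran_program) (x y : nat) :
      q * y = p * x -> fractran_step ((p, q) :: Q) x y
  | fractran_step_tail (p q : nat) (Q : fractran_program) (x y : nat) :
      ~ Nat.divide q (p * x) ->
      fractran_step Q x y -> fractran_step ((p, q) :: Q) x y.

Definition fractran_terminates (Q : fractran_program) (s : nat) : Prop :=
  exists x : nat,
    clos_refl_trans nat (fractran_step Q) s x /\
    ~ exists y : nat, fractran_step Q x y.

(** * Diophantine logic *)

(** Variables are De Bruijn indices. *)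
Inductive dio_form : Set :=
  | df_cst (i n : nat)      (* [x_i = n] *)
  | df_eq (i j : nat)       (* [x_i = x_j] *)
  | df_add (i j k : nat)    (* [x_i = x_j + x_k] *)
  | df_mul (i j k : nat)    (* [x_i = x_j * x_k] *)
  | df_conj (A B : dio_form)
  | df_disj (A B : dio_form)
  | df_exst (A : dio_form).

Definition valuation := nat -> nat.

Definition val_cons (n : nat) (nu : valuation) : valuation :=
  fun i => match i with 0 => n | S j => nu j end.

Definition val_shift (nu : valuation) : valuation := fun i => nu (S i).

Fixpoint df_sem (A : dio_form) (nu : valuation) : Prop :=
  match A with
  | df_cst i n => nu i = n
  | df_eq i j => nu i = nu j
  | df_add i j k => nu i = nu j + nu k
  | df_mul i j k => nu i = nu j * nu k
  | df_conj A B => df_sem A nu /\ df_sem B nu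
  | df_disj A B => df_sem A nu \/ df_sem B nu
  | df_exst A => exists n : nat, df_sem A (val_cons n nu)
  end.

(** Diophantine witnesses are informative (sigma types, not mere existence):
    a function between such types is a map that computes one witness from
    another. *)
Definition dio_rel (S : valuation -> Prop) : Set :=
  {A : dio_form | forall nu : valuation, df_sem A nu <-> S nu}.

Definition dio_fun (f : valuation -> nat) : Set :=
  dio_rel (fun nu => nu 0 = f (val_shift nu)).

(* Main.v *)
(** The argument follows the Davis-Putnam-Robinson-Matiyasevich theorem.  The
    solutions of the Pell equation [x^2 - (a^2 - 1) y^2 = 1] form a sequence whose
    graph is Diophantine (Matiyasevich), and [x_k - (a - n) y_k] is congruent to
    [n^k] modulo [2 a n - n^2 - 1], so exponentiation is Diophantine.  Hence so are
    the digits [binom n k] of [(1 + z)^n] in base [z = 2^(n+1)], and, by Lucas'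
    theorem modulo 2, the relation "each binary digit of [a] is at most that of [b]".

    For a program without the fraction [0/0], one step is a finite union of relations
    [x = a u + b, y = c u + d].  A run is stored as numbers whose digits, in a base
    [2^k] too large for carries, are the successive states, parameters [u] and choices
    of rules; consecutive digits are related by linear equations between these numbers,
    and the binary masks control which digits may be nonzero.  A program containing
    [0/0] can always make a step. *)

From Stdlib Require Import ZArith Znumtheory Arith List Relations Lia.
Require Import Defs.
Import ListNotations.

(** * Diophantine combinators *)

Local Open Scope nat_scope.

Fixpoint df_ren (rho : nat -> nat) (A : dio_form) : dio_form :=
  match A with
  | df_cst i n => df_cst (rho i) n
  | df_eq i j => df_eq (rho i) (rho j)
  | df_add i j k => df_add (rho i) (rho j) (rho k)
  | df_mul i j k => df_mul (rho i) (rho j) (rho k)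
  | df_conj A B => df_conj (df_ren rho A) (df_ren rho B)
  | df_disj A B => df_disj (df_ren rho A) (df_ren rho B)
  | df_exst A =>
      df_exst (df_ren (fun i => match i with 0 => 0 | S j => S (rho j) end) A)
  end.

(** Relating the valuations pointwise avoids functional extensionality under the quantifier. *)
Lemma df_ren_sem (A : dio_form) : forall (rho : nat -> nat) (mu nu : valuation),
  (forall i, mu i = nu (rho i)) -> df_sem (df_ren rho A) nu <-> df_sem A mu.
Proof.
  induction A as [i n|i j|i j k|i j k|A IHA B IHB|A IHA B IHB|A IHA];
    intros rho mu nu E; simpl; rewrite ?E; try tauto.
  - rewrite (IHA _ mu nu E), (IHB _ mu nu E); tauto.
  - rewrite (IHA _ mu nu E), (IHB _ mu nu E); tauto.
  - split; intros [n Hn]; exists n; revert Hn; apply IHA;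
      intros [|i]; simpl; auto.
Qed.

Lemma dio_iff (R T : valuation -> Prop) :
  (forall nu, T nu <-> R nu) -> dio_rel R -> dio_rel T.
Proof.
  intros E [A HA]. exists A. intro nu. rewrite HA, E. tauto.
Defined.

Lemma dio_conj (R T : valuation -> Prop) :
  dio_rel R -> dio_rel T -> dio_rel (fun nu => R nu /\ T nu).
Proof.
  intros [A HA] [B HB]. exists (df_conj A B). intro nu. simpl.
  rewrite HA, HB. tauto.
Defined.

Lemma dio_disj (R T : valuation -> Prop) :
  dio_rel R -> dio_rel T -> dio_rel (fun nu => R nu \/ T nu).
Proof.
  intros [A HA] [B HB]. exists (df_disj A B). intro nu. simpl.
  rewrite HA, HB. tauto.
Defined.

Lemma dio_ex (T : nat -> valuation -> Prop) :
  dio_rel (fun nu => T (nu 0) (val_shift nu)) ->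
  dio_rel (fun nu => exists n, T n nu).
Proof.
  intros [A HA]. exists (df_exst A). intro nu. simpl.
  split; intros [n Hn]; exists n; apply (HA (val_cons n nu)); exact Hn.
Defined.

Lemma dio_ren (T : valuation -> Prop) (rho : nat -> nat) :
  dio_rel T -> dio_rel (fun nu => T (fun i => nu (rho i))).
Proof.
  intros [A HA]. exists (df_ren rho A). intro nu.
  rewrite (df_ren_sem A rho (fun i => nu (rho i)) nu) by auto. apply HA.
Defined.

(** Variable 0 of the graph, which carries the value, may be sent to any variable [k]. *)
Lemma dio_graph_ren (f : valuation -> nat) (k : nat) (rho : nat -> nat) :
  dio_fun f -> dio_rel (fun nu => nu k = f (fun i => nu (rho i))).
Proof.
  intro H.
  exact (dio_ren _ (fun i => match i with 0 => k | S j => rho j end) H).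
Defined.

Lemma dio_fun_ren (f : valuation -> nat) (rho : nat -> nat) :
  dio_fun f -> dio_fun (fun nu => f (fun i => nu (rho i))).
Proof.
  intro H. exact (dio_graph_ren f 0 (fun i => S (rho i)) H).
Defined.

Lemma dio_var (k : nat) : dio_fun (fun nu => nu k).
Proof. exists (df_eq 0 (S k)). intro nu. reflexivity. Defined.

Lemma dio_cst (n : nat) : dio_fun (fun _ => n).
Proof. exists (df_cst 0 n). intro nu. reflexivity. Defined.

Lemma dio_op2 (op : nat -> nat -> nat) (f g : valuation -> nat) :
  dio_rel (fun nu => nu 0 = op (nu 1) (nu 2)) ->
  dio_fun f -> dio_fun g -> dio_fun (fun nu => op (f nu) (g nu)).
Proof.
  intros Hop Hf Hg.
  apply dio_iff with (R := fun nu => exists a b, a = f (val_shift nu) /\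
    b = g (val_shift nu) /\ nu 0 = op a b).
  - intro nu. split.
    + intro E. exists (f (val_shift nu)), (g (val_shift nu)). auto.
    + intros (a & b & -> & -> & E). exact E.
  (* Under the two quantifiers [b] is variable 0, [a] is 1, the value is 2 and the arguments start
     at 3. *)
  - apply dio_ex, dio_ex, dio_conj; [|apply dio_conj].
    + exact (dio_graph_ren f 1 (fun i => S (S (S i))) Hf).
    + exact (dio_graph_ren g 0 (fun i => S (S (S i))) Hg).
    + exact (dio_ren _ (fun i => match i with 0 => 2 | 1 => 1 | _ => 0 end) Hop).
Defined.

Lemma dio_add (f g : valuation -> nat) :
  dio_fun f -> dio_fun g -> dio_fun (fun nu => f nu + g nu).
Proof.
  apply (dio_op2 Nat.add). exists (df_add 0 1 2). reflexivity.
Defined.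

Lemma dio_mul (f g : valuation -> nat) :
  dio_fun f -> dio_fun g -> dio_fun (fun nu => f nu * g nu).
Proof.
  apply (dio_op2 Nat.mul). exists (df_mul 0 1 2). reflexivity.
Defined.

Lemma dio_eq (f g : valuation -> nat) :
  dio_fun f -> dio_fun g -> dio_rel (fun nu => f nu = g nu).
Proof.
  intros Hf Hg.
  apply dio_iff with (R := fun nu => exists a, a = f nu /\ a = g nu).
  - intro nu. split.
    + intro E. exists (f nu). auto.
    + intros (a & -> & E). exact E.
  - apply dio_ex, dio_conj; [exact Hf|exact Hg].
Defined.

Create HintDb dio.
#[local] Hint Extern 0 (dio_rel (fun _ => _ /\ _)) => apply dio_conj : dio.
#[local] Hint Extern 0 (dio_rel (fun _ => _ \/ _)) => apply dio_disj : dio.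
#[local] Hint Extern 0 (dio_rel (fun _ => exists _, _)) =>
  apply dio_ex; unfold val_shift; cbv beta : dio.
#[local] Hint Extern 0 (dio_rel (fun _ => _ = _)) => apply dio_eq : dio.
#[local] Hint Extern 0 (dio_fun (fun _ => _ + _)) => apply dio_add : dio.
#[local] Hint Extern 0 (dio_fun (fun _ => _ * _)) => apply dio_mul : dio.
#[local] Hint Extern 0 (dio_fun (fun nu => nu _)) => apply dio_var : dio.
#[local] Hint Extern 1 (dio_fun (fun _ => _)) => apply dio_cst : dio.
(* An assumed [f] may be applied to a valuation shifted by the quantifiers opened so far. *)
#[local] Hint Extern 2 (dio_fun _) =>
  match goal with
  | H : dio_fun ?f |- _ => first [exact H | exact (dio_fun_ren f _ H)]
  end : dio.

Ltac dio := auto 200 with dio nocore.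

Lemma dio_le (f g : valuation -> nat) :
  dio_fun f -> dio_fun g -> dio_rel (fun nu => f nu <= g nu).
Proof.
  intros Hf Hg. apply dio_iff with (R := fun nu => exists c, g nu = f nu + c).
  - intro nu. split.
    + intro L. exists (g nu - f nu). lia.
    + intros [c E]. lia.
  - dio.
Defined.

Lemma dio_lt (f g : valuation -> nat) :
  dio_fun f -> dio_fun g -> dio_rel (fun nu => f nu < g nu).
Proof.
  intros Hf Hg. apply (dio_le (fun nu => 1 + f nu) g); dio.
Defined.

#[local] Hint Extern 0 (dio_rel (fun _ => _ <= _)) => apply dio_le : dio.
#[local] Hint Extern 0 (dio_rel (fun _ => _ < _)) => apply dio_lt : dio.

(* Subtraction-free, to be directly expressible in [dio_form]. *)
Definition congr (a b m : nat) : Prop := exists p q, a + p * m = b + q * m.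

Lemma congr_iff (a b m : nat) :
  congr a b m <-> (Z.of_nat m | Z.of_nat a - Z.of_nat b)%Z.
Proof.
  split.
  - intros (p & q & E). exists (Z.of_nat q - Z.of_nat p)%Z. nia.
  - intros [z E]. destruct (Z_le_gt_dec 0 z) as [L|L].
    + exists 0, (Z.to_nat z). nia.
    + exists (Z.to_nat (- z)), 0. nia.
Qed.

Lemma dio_congr (f g h : valuation -> nat) :
  dio_fun f -> dio_fun g -> dio_fun h ->
  dio_rel (fun nu => congr (f nu) (g nu) (h nu)).
Proof. intros Hf Hg Hh. unfold congr. dio. Defined.

#[local] Hint Extern 0 (dio_rel (fun _ => congr _ _ _)) => apply dio_congr : dio.

(** * The Pell equation *)

Local Open Scope Z_scope.

(** The pair (x, y) with x + y sqrt(a^2 - 1) = (a + sqrt(a^2 - 1))^n. *)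
Fixpoint pell (a : Z) (n : nat) : Z * Z :=
  match n with
  | O => (1, 0)
  | S n => let (x, y) := pell a n in (a * x + (a * a - 1) * y, x + a * y)
  end.

Definition px (a : Z) (n : nat) : Z := fst (pell a n).
Definition py (a : Z) (n : nat) : Z := snd (pell a n).

Lemma px_S (a : Z) (n : nat) : px a (S n) = a * px a n + (a * a - 1) * py a n.
Proof. unfold px, py. simpl. destruct (pell a n). reflexivity. Qed.

Lemma py_S (a : Z) (n : nat) : py a (S n) = px a n + a * py a n.
Proof. unfold px, py. simpl. destruct (pell a n). reflexivity. Qed.

Lemma pell_norm (a : Z) (n : nat) :
  px a n * px a n - (a * a - 1) * (py a n * py a n) = 1.
Proof.
  induction n as [|n IH]; [change (px a 0) with 1; change (py a 0) with 0; ring|].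
  rewrite px_S, py_S. etransitivity; [|exact IH]. ring.
Qed.

(** Multiply the powers with exponents [m] and [n]; each coordinate needs the other in the
    induction. *)
Lemma pell_add (a : Z) (m n : nat) :
  px a (m + n) = px a m * px a n + (a * a - 1) * (py a m * py a n) /\
  py a (m + n) = px a m * py a n + py a m * px a n.
Proof.
  induction m as [|m [IHx IHy]].
  - change (px a 0) with 1. change (py a 0) with 0. cbn [Nat.add]. split; ring.
  - simpl (S m + n)%nat. rewrite !px_S, !py_S, IHx, IHy. split; ring.
Qed.

Lemma px_add (a : Z) (m n : nat) :
  px a (m + n) = px a m * px a n + (a * a - 1) * (py a m * py a n).
Proof. apply pell_add. Qed.

Lemma py_add (a : Z) (m n : nat) :
  py a (m + n) = px a m * py a n + py a m * px a n.
Proof. apply pell_add. Qed.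

Lemma pell_pos (a : Z) (n : nat) : 1 < a -> 0 < px a n /\ 0 <= py a n.
Proof.
  intro Ha. induction n as [|n [IHx IHy]]; [easy|].
  rewrite px_S, py_S.
  assert (0 <= (a * a - 1) * py a n) by (apply Z.mul_nonneg_nonneg; nia). split; nia.
Qed.

Lemma px_growth (a : Z) (n : nat) : 1 < a -> a * px a n <= px a (S n).
Proof.
  intro Ha. rewrite px_S. destruct (pell_pos a n Ha).
  assert (0 <= (a * a - 1) * py a n) by (apply Z.mul_nonneg_nonneg; nia). lia.
Qed.

Lemma px_lt (a : Z) (m n : nat) : 1 < a -> (m < n)%nat -> a * px a m <= px a n.
Proof.
  intros Ha L. induction L as [|n L IH]; [now apply px_growth|].
  pose proof (px_growth a n Ha). pose proof (proj1 (pell_pos a n Ha)). nia.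
Qed.

Lemma py_lt (a : Z) (m n : nat) : 1 < a -> (m < n)%nat -> py a m < py a n.
Proof.
  intros Ha L.
  assert (G : forall k, py a k < py a (S k)).
  { intro k. rewrite py_S. destruct (pell_pos a k Ha). nia. }
  induction L as [|n L IH]; [apply G|]. specialize (G n). lia.
Qed.

Lemma py_ge (a : Z) (n : nat) : 1 < a -> Z.of_nat n <= py a n.
Proof.
  intro Ha. induction n as [|n IH]; [easy|].
  pose proof (py_lt a n (S n) Ha ltac:(lia)). lia.
Qed.

Lemma px_ge_pow (a : Z) (n : nat) : 1 < a -> a ^ Z.of_nat n <= px a n.
Proof.
  intro Ha. induction n as [|n IH]; [easy|].
  rewrite Nat2Z.inj_succ, Z.pow_succ_r by lia.
  pose proof (px_growth a n Ha). nia.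
Qed.

Lemma pell_complete (a : Z) : 1 < a -> forall y x, 0 <= y -> 0 <= x ->
  x * x - (a * a - 1) * (y * y) = 1 -> exists n, x = px a n /\ y = py a n.
Proof.
  intros Ha y x Hy. revert x. pattern y.
  apply Zlt_0_ind; [clear y Hy; intros y IH Hy x Hx E|exact Hy].
  destruct (Z.eq_dec y 0) as [->|Ny].
  { exists O. split; [|reflexivity]. change (px a 0) with 1. nia. }
  (* Multiplication by [a - sqrt (a^2-1)] descends to a smaller solution. *)
  assert (L1 : (a - 1) * y < x).
  { apply Z.nle_gt. intro L. assert (x * x <= ((a - 1) * y) * ((a - 1) * y)) by nia.
    assert (0 < y * y) by nia. nia. }
  assert (L2 : x <= a * y).
  { apply Z.nlt_ge. intro L. assert ((a * y) * (a * y) < x * x) by nia. nia. }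
  assert (L3 : 0 <= a * x - (a * a - 1) * y).
  { assert (a * ((a - 1) * y) + y <= a * x + 0) by nia. nia. }
  destruct (IH (a * y - x) ltac:(lia) (a * x - (a * a - 1) * y) L3)
    as (n & En & Em).
  { etransitivity; [|exact E]. ring. }
  exists (S n). rewrite px_S, py_S, <- En, <- Em. split; ring.
Qed.

Lemma pell_coprime (a : Z) (n : nat) : rel_prime (py a n) (px a n).
Proof.
  apply bezout_rel_prime.
  apply (Bezout_intro _ _ _ (- ((a * a - 1) * py a n)) (px a n)).
  pose proof (pell_norm a n). lia.
Qed.

(** Modulo [a - 1] the recurrence is that of base 1, with solution x = 1, y = n; so a value reveals
    its index. *)
Lemma py_mod (a : Z) (n : nat) : (a - 1 | py a n - Z.of_nat n).
Proof.
  assert (H : (a - 1 | py a n - Z.of_nat n) /\ (a - 1 | px a n - 1)).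
  { induction n as [|n [[p Hp] [q Hq]]].
    - split; exists 0; reflexivity.
    - rewrite px_S, py_S, Nat2Z.inj_succ.
      split; [exists (q + a * p + Z.of_nat n)|exists (a * q + 1 + (a + 1) * py a n)]; nia. }
  apply H.
Qed.

(** Both coordinates are integer polynomials in the base. *)
Lemma pell_congr_base (a b m : Z) (n : nat) : (m | b - a) ->
  (m | px b n - px a n) /\ (m | py b n - py a n).
Proof.
  intros Hab. induction n as [|n [Hp Hq]].
  - split; exists 0; reflexivity.
  - rewrite !px_S, !py_S. split.
    + replace (b * px b n + (b * b - 1) * py b n - (a * px a n + (a * a - 1) * py a n))
        with ((b - a) * px b n + a * (px b n - px a n)
              + (b - a) * ((b + a) * py b n) + (a * a - 1) * (py b n - py a n)) by ring.
      auto 10 using Z.divide_add_r, Z.divide_mul_l, Z.divide_mul_r.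
    + replace (px b n + b * py b n - (px a n + a * py a n))
        with ((px b n - px a n) + (b - a) * py b n + a * (py b n - py a n)) by ring.
      auto 10 using Z.divide_add_r, Z.divide_mul_l, Z.divide_mul_r.
Qed.

(* First-order binomial expansion of [(x + y sqrt d)^q]. *)
Lemma pell_mul (a : Z) (m q : nat) : exists c e,
  px a (q * m) = px a m ^ Z.of_nat q + py a m * c /\
  px a m * py a (q * m) =
    py a m * (Z.of_nat q * px a m ^ Z.of_nat q + py a m * e).
Proof.
  induction q as [|q (c & e & Hc & He)].
  - exists 0, 0. change (px a (0 * m)) with 1. change (py a (0 * m)) with 0.
    change (Z.of_nat 0) with 0. rewrite Z.pow_0_r. split; ring.
  - simpl (S q * m)%nat. rewrite px_add, py_add, Nat2Z.inj_succ, Z.pow_succ_r by lia.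
    set (x := px a m) in *. set (y := py a m) in *.
    exists (x * c + (a * a - 1) * py a (q * m)), (x * c + x * e).
    split; [rewrite Hc; ring|].
    replace (x * (x * py a (q * m) + y * px a (q * m)))
      with (x * (x * py a (q * m)) + x * y * px a (q * m)) by ring.
    rewrite He, Hc. unfold Z.succ. ring.
Qed.

(** * Divisibility between y-coordinates *)

Lemma py_dvd_mul (a : Z) (m q : nat) : (py a m | py a (q * m)).
Proof.
  induction q as [|q IH]; [exists 0; reflexivity|].
  simpl (S q * m)%nat. rewrite py_add.
  auto using Z.divide_add_r, Z.divide_mul_l, Z.divide_mul_r, Z.divide_refl.
Qed.

(** Write n = q m + r. By the addition formula and coprimality, [py a m] divides [py a r], which is
    smaller as r < m; hence r = 0. *)
Lemma py_dvd_inv (a : Z) (m n : nat) : 1 < a -> (0 < m)%nat ->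
  (py a m | py a n) -> exists q, n = (q * m)%nat.
Proof.
  intros Ha Hm H. exists (n / m)%nat.
  pose proof (Nat.div_mod_eq n m) as E.
  pose proof (Nat.mod_upper_bound n m ltac:(lia)) as L.
  set (r := (n mod m)%nat) in *. set (q := (n / m)%nat) in *.
  assert (D : (py a m | py a r)).
  { assert (R : rel_prime (py a m) (px a (q * m))).
    { apply rel_prime_div with (py a (q * m)); [apply pell_coprime|apply py_dvd_mul]. }
    apply (Gauss _ (px a (q * m))); [|exact R].
    rewrite E, Nat.mul_comm, py_add in H.
    replace (px a (q * m) * py a r) with
      (px a (q * m) * py a r + py a (q * m) * px a r - py a (q * m) * px a r) by ring.
    apply Z.divide_sub_r; [exact H|].
    apply Z.divide_mul_l, py_dvd_mul. }
  destruct (Nat.eq_dec r 0) as [Z0|N0]; [lia|exfalso].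
  pose proof (py_lt a r m Ha L). pose proof (py_lt a 0 r Ha ltac:(lia)).
  change (py a 0) with 0 in *. apply Z.divide_pos_le in D; lia.
Qed.

Lemma rel_prime_pow (x y : Z) (n : nat) :
  rel_prime y x -> rel_prime y (x ^ Z.of_nat n).
Proof.
  intro H. induction n as [|n IH].
  - apply rel_prime_sym, rel_prime_1.
  - rewrite Nat2Z.inj_succ, Z.pow_succ_r by lia. now apply rel_prime_mult.
Qed.

(** Put n = q m. By the expansion in [pell_mul], y divides q x^q, and y is coprime to x.
    Divisibility of values thus passes to indices. *)
Lemma py_sq_dvd (a : Z) (m n : nat) : 1 < a -> (0 < m)%nat ->
  (py a m * py a m | py a n) -> (py a m | Z.of_nat n).
Proof.
  intros Ha Hm [z Hz].
  destruct (py_dvd_inv a m n Ha Hm) as [q ->].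
  { exists (z * py a m). lia. }
  destruct (pell_mul a m q) as (c & e & _ & He).
  assert (P : 0 < py a m) by (pose proof (py_lt a 0 m Ha Hm); easy).
  rewrite Nat2Z.inj_mul. apply Z.divide_mul_l.
  apply (Gauss _ (px a m ^ Z.of_nat q)).
  2: apply rel_prime_pow, pell_coprime.
  exists (px a m * z - e).
  apply (Z.mul_reg_l _ _ (py a m)); [lia|].
  rewrite Hz in He. nia.
Qed.

(** The same expansion read backwards; it supplies the solution (u, v) of [pell_system]. *)
Lemma py_sq_dvd_mul (a : Z) (m q : nat) : (py a m | Z.of_nat q) ->
  (py a m * py a m | py a (q * m)).
Proof.
  intros [z Hz]. destruct (pell_mul a m q) as (c & e & _ & He).
  apply (Gauss _ (px a m)).
  - exists (z * px a m ^ Z.of_nat q + e). rewrite He, Hz. ring.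
  - apply rel_prime_sym, rel_prime_mult; apply rel_prime_sym, pell_coprime.
Qed.

(** * Congruences modulo [px a n] *)

(** The power with exponent 2 n is congruent to -1: its coordinates are 2 x^2 - 1 and 2 x y. *)
Lemma px_double_add (a : Z) (n j : nat) :
  (px a n | px a (n + n + j) + px a j).
Proof.
  rewrite !px_add, !py_add. pose proof (pell_norm a n) as N.
  set (x := px a n) in *. set (y := py a n) in *.
  exists (2 * x * px a j + 2 * (a * a - 1) * y * py a j).
  replace ((a * a - 1) * (y * y)) with (x * x - 1) by lia. ring.
Qed.

Lemma px_double_sub (a : Z) (n j : nat) : (j <= n + n)%nat ->
  (px a n | px a (n + n - j) + px a j).
Proof.
  intro L. set (i := (n + n - j)%nat).
  pose proof (px_add a i j) as Ex. pose proof (py_add a i j) as Ey.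
  replace (i + j)%nat with (n + n)%nat in Ex, Ey by lia.
  rewrite px_add in Ex. rewrite py_add in Ey.
  pose proof (pell_norm a j) as Nj. pose proof (pell_norm a n) as Nn.
  set (x := px a n) in *. set (y := py a n) in *.
  (* Solve the addition formulas for [px a i] by multiplying with the conjugate of the power with
     exponent [j], which has norm 1. *)
  assert (E : px a i = (x * x + (a * a - 1) * (y * y)) * px a j
                       - (a * a - 1) * ((x * y + y * x) * py a j)).
  { rewrite Ex, Ey.
    transitivity (px a i * (px a j * px a j - (a * a - 1) * (py a j * py a j)));
      [rewrite Nj|]; ring. }
  rewrite E.
  exists (2 * x * px a j - 2 * (a * a - 1) * y * py a j).
  replace ((a * a - 1) * (y * y)) with (x * x - 1) by lia. ring.
Qed.

(** The values are positive and increase strictly up to the modulus. *)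
Lemma px_congr_small (a : Z) (n i j : nat) : 3 <= a -> (i <= n)%nat -> (j <= n)%nat ->
  (px a n | px a i - px a j) -> i = j.
Proof.
  intros Ha.
  assert (W : forall i j, (i < j)%nat -> (j <= n)%nat -> ~ (px a n | px a j - px a i)).
  { intros i' j' L1 L2 D. pose proof (px_lt a i' j' ltac:(lia) L1).
    pose proof (proj1 (pell_pos a i' ltac:(lia))).
    assert (px a j' <= px a n).
    { destruct (Nat.eq_dec j' n) as [->|N]; [lia|].
      pose proof (px_lt a j' n ltac:(lia) ltac:(lia)).
      pose proof (proj1 (pell_pos a j' ltac:(lia))). nia. }
    apply Z.divide_pos_le in D; nia. }
  intros Hi Hj D. destruct (lt_eq_lt_dec i j) as [[L|E]|L]; [exfalso|exact E|exfalso].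
  - apply (W i j L Hj). replace (px a j - px a i) with (- (px a i - px a j)) by ring.
    now apply Z.divide_opp_r.
  - exact (W j i L Hi D).
Qed.

(** For a >= 3, values below index n are at most a third of the modulus, so two of them cannot add
    up to a multiple of it. *)
Lemma px_congr_opp_small (a : Z) (n i j : nat) : 3 <= a ->
  (i <= n)%nat -> (j <= n)%nat -> (px a n | px a i + px a j) -> i = n /\ j = n.
Proof.
  intros Ha.
  assert (B : forall i, (i < n)%nat -> 0 < px a i /\ 3 * px a i <= px a n).
  { intros k L. pose proof (px_lt a k n ltac:(lia) L).
    pose proof (proj1 (pell_pos a k ltac:(lia))). nia. }
  intros Hi Hj D. destruct (Nat.eq_dec i n) as [->|Ni], (Nat.eq_dec j n) as [->|Nj];
    auto; exfalso.
  - specialize (B j ltac:(lia)). apply (Z.divide_add_cancel_r _ (px a n)) in D; [|apply Z.divide_refl].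
    apply Z.divide_pos_le in D; lia.
  - specialize (B i ltac:(lia)). rewrite Z.add_comm in D.
    apply (Z.divide_add_cancel_r _ (px a n)) in D; [|apply Z.divide_refl].
    apply Z.divide_pos_le in D; lia.
  - pose proof (B i ltac:(lia)). pose proof (B j ltac:(lia)).
    apply Z.divide_pos_le in D; lia.
Qed.

(** An index j > n is reflected to 2 n - j with a change of sign, which [px_congr_opp_small] rules
    out. *)
Lemma px_congr_le_double (a : Z) (n i j : nat) : 3 <= a ->
  (i <= n)%nat -> (j <= n + n)%nat -> (px a n | px a j - px a i) -> j = i.
Proof.
  intros Ha Hi Hj D. destruct (le_lt_dec j n) as [L|L].
  - now apply (px_congr_small a n).
  - pose proof (px_double_sub a n j Hj) as E.
    destruct (px_congr_opp_small a n (n + n - j) i Ha) as [E1 E2]; try lia.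
    replace (px a (n + n - j) + px a i) with
      (px a (n + n - j) + px a j - (px a j - px a i)) by ring.
    now apply Z.divide_sub_r.
Qed.

(** Two shifts by 2 n restore the sign. *)
Lemma px_period (a : Z) (n j q : nat) : (px a n | px a (q * (4 * n) + j) - px a j).
Proof.
  induction q as [|q IH]; [simpl; rewrite Z.sub_diag; apply Z.divide_0_r|].
  set (k := (q * (4 * n) + j)%nat) in *.
  replace (S q * (4 * n) + j)%nat with (n + n + (n + n + k))%nat by lia.
  replace (px a (n + n + (n + n + k)) - px a j) with
    (px a (n + n + (n + n + k)) + px a (n + n + k) - (px a (n + n + k) + px a k)
     + (px a k - px a j)) by ring.
  apply Z.divide_add_r; [apply Z.divide_sub_r; apply px_double_add|exact IH].
Qed.

(** Reduce j to r modulo the period 4 n; if r > 2 n, replace it by 4 n - r, which has the same value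
    modulo [px a n]. *)
Lemma px_congr (a : Z) (n i j : nat) : 3 <= a -> (0 < n)%nat -> (i <= n)%nat ->
  (px a n | px a j - px a i) ->
  (Z.of_nat (4 * n) | Z.of_nat j - Z.of_nat i) \/
  (Z.of_nat (4 * n) | Z.of_nat j + Z.of_nat i).
Proof.
  intros Ha Hn Hi D.
  pose proof (Nat.div_mod_eq j (4 * n)) as E.
  pose proof (Nat.mod_upper_bound j (4 * n) ltac:(lia)) as L.
  set (r := (j mod (4 * n))%nat) in *. set (q := (j / (4 * n))%nat) in *.
  assert (Dr : (px a n | px a r - px a i)).
  { pose proof (px_period a n r q) as P.
    rewrite (Nat.mul_comm q), <- E in P.
    replace (px a r - px a i) with ((px a j - px a i) - (px a j - px a r)) by ring.
    now apply Z.divide_sub_r. }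
  destruct (le_lt_dec r (n + n)) as [Lr|Lr].
  - left. apply (px_congr_le_double a n i r Ha Hi Lr) in Dr.
    exists (Z.of_nat q). nia.
  - right.
    assert (Dr' : (px a n | px a (4 * n - r) - px a i)).
    { pose proof (px_double_sub a n (r - (n + n)) ltac:(lia)) as P1.
      pose proof (px_double_add a n (r - (n + n))) as P2.
      replace (n + n - (r - (n + n)))%nat with (4 * n - r)%nat in P1 by lia.
      replace (n + n + (r - (n + n)))%nat with r in P2 by lia.
      replace (px a (4 * n - r) - px a i) with
        (px a (4 * n - r) + px a (r - (n + n)) - (px a r + px a (r - (n + n)))
         + (px a r - px a i)) by ring.
      apply Z.divide_add_r; [now apply Z.divide_sub_r|exact Dr]. }
    apply (px_congr_le_double a n i (4 * n - r) Ha Hi ltac:(lia)) in Dr'.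
    exists (Z.of_nat q + 1). nia.
Qed.

(** * The graph of the Pell sequence and exponentiation *)

Definition pell_graph (a k x y : nat) : Prop :=
  Z.of_nat x = px (Z.of_nat a) k /\ Z.of_nat y = py (Z.of_nat a) k.

Definition pell_eq (a x y : nat) : Prop :=
  (x * x + y * y = 1 + a * a * (y * y))%nat.

Lemma pell_eq_iff (a x y : nat) : (1 < a)%nat ->
  pell_eq a x y <-> exists n, pell_graph a n x y.
Proof.
  intro Ha. unfold pell_eq, pell_graph. split.
  - intro E. apply pell_complete; nia.
  - intros [n [Ex Ey]]. pose proof (pell_norm (Z.of_nat a) n) as N.
    rewrite <- Ex, <- Ey in N. nia.
Qed.

(** Matiyasevich's method: y^2 | v makes y divide the index of (u, v). In the auxiliary base b, the
    congruence b = a mod u lets s = x mod u fix the index of (s, t) up to sign modulo 4 y, and b = 1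
    mod 4 y lets t reveal that index. *)
Definition pell_system (a k x y : nat) : Prop :=
  (k <= y /\ 0 < y /\ pell_eq a x y /\
   exists u v s t b z, pell_eq a u v /\ pell_eq b s t /\
     1 < b /\ congr b 1 (4 * y) /\ congr b a u /\
     0 < v /\ v = y * y * z /\ congr s x u /\ congr t k (4 * y))%nat.

Lemma pell_system_sound (a k x y : nat) :
  (3 <= a)%nat -> pell_system a k x y -> pell_graph a k x y.
Proof.
  intros Ha (Lk & Ly & E1 & u & v & s & t & b & z & E2 & E3 & Hb & Cb1 & Cba & Hv & Ev & Cs & Ct).
  apply pell_eq_iff in E1 as [i G1]; [|lia].
  apply pell_eq_iff in E2 as [n [Eu Ev']]; [|lia].
  apply pell_eq_iff in E3 as [j [Es Et]]; [|lia].
  enough (k = i) by (subst; exact G1).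
  destruct G1 as [Ex Ey].
  rewrite congr_iff in Cb1, Cba, Cs, Ct.
  rewrite Nat2Z.inj_mul in Cb1, Ct. change (Z.of_nat 4) with 4 in *. change (Z.of_nat 1) with 1 in *.
  set (A := Z.of_nat a) in *. set (B := Z.of_nat b) in *.
  assert (HA : 3 <= A) by lia.
  assert (Hi : (0 < i)%nat).
  { destruct i; [|lia]. change (py A 0) with 0 in Ey. lia. }
  assert (Hn : (0 < n)%nat).
  { destruct n; [|lia]. change (py A 0) with 0 in Ev'. lia. }
  assert (Dn : (Z.of_nat y | Z.of_nat n)).
  { rewrite Ey. apply py_sq_dvd; [lia|exact Hi|]. exists (Z.of_nat z).
    rewrite <- Ey, <- Ev'. lia. }
  assert (Hiy : (i <= y)%nat) by (pose proof (py_ge A i ltac:(lia)); lia).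
  assert (Hyn : (y <= n)%nat) by (apply Z.divide_pos_le in Dn; lia).
  assert (Dj : (px A n | px A j - px A i)).
  { replace (px A j - px A i) with ((px B j - px A i) - (px B j - px A j)) by ring.
    apply Z.divide_sub_r; [rewrite <- Eu, <- Es, <- Ex; exact Cs|].
    apply pell_congr_base. rewrite <- Eu. exact Cba. }
  assert (D4 : (4 * Z.of_nat y | Z.of_nat (4 * n))).
  { rewrite Nat2Z.inj_mul. apply Z.mul_divide_mono_l, Dn. }
  assert (Djk : (4 * Z.of_nat y | Z.of_nat j - Z.of_nat k)).
  { replace (Z.of_nat j - Z.of_nat k) with
      ((Z.of_nat t - Z.of_nat k) - (py B j - Z.of_nat j)) by lia.
    apply Z.divide_sub_r; [exact Ct|]. apply (Z.divide_trans _ (B - 1)); [exact Cb1|].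
    apply py_mod. }
  (* Modulo 4 y, j is congruent to k and, up to sign, to i. As 0 < i <= y and 0 <= k <= y, this
     leaves only k = i. *)
  destruct (px_congr A n i j HA Hn ltac:(lia) Dj) as [D|D];
    apply (Z.divide_trans _ _ _ D4) in D; pose proof (Z.divide_sub_r _ _ _ D Djk) as [w Hw].
  - assert (w = 0) by nia. nia.
  - assert (w <= 0 \/ 1 <= w) as [?|?] by lia; nia.
Qed.

Lemma pell_system_complete (a k x y : nat) :
  (3 <= a)%nat -> (0 < k)%nat -> pell_graph a k x y -> pell_system a k x y.
Proof.
  intros Ha Hk [Ex Ey].
  set (A := Z.of_nat a) in *.
  assert (HA : 3 <= A) by lia.
  pose proof (py_ge A k ltac:(lia)) as Lk.
  assert (Hy : (0 < y)%nat) by lia.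
  (* The factor y makes y^2 divide v; the factor 2 makes u odd, hence coprime to 4. *)
  set (n := (y * k + y * k)%nat).
  destruct (Z_of_nat_complete (px A n)) as [u Eu]; [destruct (pell_pos A n); lia|].
  destruct (Z_of_nat_complete (py A n)) as [v Ev]; [destruct (pell_pos A n); lia|].
  assert (Hu : 0 < Z.of_nat u) by (destruct (pell_pos A n); lia).
  assert (Hv : (0 < v)%nat) by (pose proof (py_ge A n ltac:(lia)); nia).
  assert (Dv : (Z.of_nat y * Z.of_nat y | Z.of_nat v)).
  { rewrite <- Ev, Ey. replace n with ((2 * y) * k)%nat by lia.
    apply py_sq_dvd_mul. exists 2. lia. }
  assert (R : rel_prime (Z.of_nat u) (4 * Z.of_nat y)).
  { apply rel_prime_mult.
    - apply bezout_rel_prime. pose proof (px_add A (y * k) (y * k)) as E.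
      fold n in E. rewrite Eu in E. pose proof (pell_norm A (y * k)) as N.
      set (c := px A (y * k)) in *.
      apply (Bezout_intro _ _ _ (Z.of_nat u) (- (c * c * (c * c) - c * c))).
      replace (Z.of_nat u) with (2 * (c * c) - 1) by lia. ring.
    - apply rel_prime_sym, rel_prime_div with (Z.of_nat v).
      + rewrite <- Ev, <- Eu. apply pell_coprime.
      + apply (Z.divide_trans _ _ _ (Z.divide_factor_l _ _) Dv). }
  apply rel_prime_bezout in R as [q p Bez].
  (* Chinese remainders modulo 4 y and u; [B] adds a multiple of both moduli in order to exceed
     1. *)
  set (b0 := q * Z.of_nat u + A * (p * (4 * Z.of_nat y))).
  set (B := b0 + 4 * Z.of_nat y * Z.of_nat u * (Z.abs b0 + 2)).
  assert (HB : 1 < B).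
  { unfold B. assert (1 <= 4 * Z.of_nat y * Z.of_nat u) by nia. nia. }
  assert (DB1 : (4 * Z.of_nat y | B - 1)).
  { exists (A * p - p + Z.of_nat u * (Z.abs b0 + 2)). rewrite <- Bez at 1.
    unfold B, b0 at 1. ring. }
  assert (DBA : (Z.of_nat u | B - A)).
  { exists (q - A * q + 4 * Z.of_nat y * (Z.abs b0 + 2)).
    unfold B, b0 at 1. replace (p * (4 * Z.of_nat y)) with (1 - q * Z.of_nat u) by lia.
    ring. }
  destruct (Z_of_nat_complete B) as [b Eb]; [lia|].
  destruct (Z_of_nat_complete (px B k)) as [s Es]; [destruct (pell_pos B k HB); lia|].
  destruct (Z_of_nat_complete (py B k)) as [t Et]; [destruct (pell_pos B k HB); lia|].
  split; [lia|split; [exact Hy|split]].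
  { apply pell_eq_iff; [lia|]. exists k. split; assumption. }
  destruct Dv as [z Hz]. assert (0 <= z) by nia.
  exists u, v, s, t, b, (Z.to_nat z). repeat split.
  - apply pell_eq_iff; [lia|]. exists n. split; symmetry; assumption.
  - apply pell_eq_iff; [lia|]. exists k. unfold pell_graph. rewrite <- Eb. auto.
  - lia.
  - apply congr_iff. rewrite <- Eb, Nat2Z.inj_mul. exact DB1.
  - apply congr_iff. rewrite <- Eb. exact DBA.
  - exact Hv.
  - nia.
  - apply congr_iff. rewrite <- Es, Ex. apply pell_congr_base, DBA.
  - apply congr_iff. rewrite <- Et, Nat2Z.inj_mul.
    apply (Z.divide_trans _ _ _ DB1), py_mod.
Qed.

(** Index 0 is listed apart, since [pell_system] requires y > 0. *)
Lemma pell_graph_iff (a k x y : nat) : (3 <= a)%nat ->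
  pell_graph a k x y <->
  (k = 0 /\ x = 1 /\ y = 0)%nat \/ pell_system a k x y.
Proof.
  intro Ha. split.
  - intro G. destruct (Nat.eq_dec k 0) as [->|Nk].
    + left. destruct G as [Ex Ey]. change (Z.of_nat x = 1) in Ex.
      change (Z.of_nat y = 0) in Ey. lia.
    + right. apply pell_system_complete; auto; lia.
  - intros [(-> & -> & ->)|H]; [split; reflexivity|].
    now apply pell_system_sound.
Qed.

Lemma dio_pell_graph (a k x y : valuation -> nat) :
  dio_fun a -> dio_fun k -> dio_fun x -> dio_fun y ->
  dio_rel (fun nu => 3 <= a nu /\ pell_graph (a nu) (k nu) (x nu) (y nu))%nat.
Proof.
  intros Da Dk Dx Dy.
  apply dio_iff with (R := fun nu => (3 <= a nu /\
    ((k nu = 0 /\ x nu = 1 /\ y nu = 0) \/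
     pell_system (a nu) (k nu) (x nu) (y nu)))%nat).
  - intro nu. split; intros [L H]; (split; [exact L|]); now apply pell_graph_iff.
  - unfold pell_system, pell_eq. dio.
Defined.

#[local] Hint Extern 0 (dio_rel (fun _ => 3 <= _ /\ pell_graph _ _ _ _)%nat) =>
  apply dio_pell_graph : dio.

(* [x - (a - n) y] is multiplied by [n] at each step. *)
Lemma pell_pow_congr (a n : Z) (k : nat) :
  (2 * a * n - n * n - 1 | px a k - (a - n) * py a k - n ^ Z.of_nat k).
Proof.
  induction k as [|k IH].
  - change (px a 0) with 1. change (py a 0) with 0. change (Z.of_nat 0) with 0.
    rewrite Z.pow_0_r. exists 0. ring.
  - rewrite px_S, py_S, Nat2Z.inj_succ, Z.pow_succ_r by lia.
    match goal with |- (_ | ?r) => replace r with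
      (n * (px a k - (a - n) * py a k - n ^ Z.of_nat k)
       + (2 * a * n - n * n - 1) * py a k) by ring end.
    apply Z.divide_add_r; [now apply Z.divide_mul_r|apply Z.divide_factor_l].
Qed.

(** With A = c + n + 3 the modulus is T = 2 A n - n^2 - 1. As c >= n^k, T exceeds n^k, so m < T is
    determined by its residue, that of x - (A - n) y. *)
Definition pow_system (n k m : nat) : Prop :=
  (exists c c' x y T, (3 <= n + 3 /\ pell_graph (n + 3) k c c') /\
     T + n * n + 1 = 2 * (c + n + 3) * n /\ m < T /\
     (3 <= c + n + 3 /\ pell_graph (c + n + 3) k x y) /\
     congr (x + n * y) ((c + n + 3) * y + m) T)%nat.

Lemma pow_graph_iff (n k m : nat) : (0 < n)%nat ->
  m = (n ^ k)%nat <-> pow_system n k m.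
Proof.
  intro Hn.
  assert (G : forall c c' x y T, pell_graph (n + 3) k c c' ->
    (T + n * n + 1 = 2 * (c + n + 3) * n)%nat ->
    pell_graph (c + n + 3) k x y ->
    (n ^ k < T)%nat /\ (Z.of_nat T | Z.of_nat (x + n * y) -
      Z.of_nat ((c + n + 3) * y) - Z.of_nat (n ^ k))).
  { intros c c' x y T [Ec _] ET [Ex Ey]. split.
    - assert (n ^ k <= c)%nat; [|nia].
      pose proof (px_ge_pow (Z.of_nat (n + 3)) k ltac:(lia)) as P.
      rewrite <- Ec, <- Nat2Z.inj_pow in P.
      pose proof (Nat.pow_le_mono_l n (n + 3) k ltac:(lia)). lia.
    - pose proof (pell_pow_congr (Z.of_nat (c + n + 3)) (Z.of_nat n) k) as P.
      rewrite <- Ex, <- Ey in P. rewrite Nat2Z.inj_pow.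
      replace (Z.of_nat T) with (2 * Z.of_nat (c + n + 3) * Z.of_nat n
        - Z.of_nat n * Z.of_nat n - 1) by nia.
      rewrite (Nat2Z.inj_add x), !Nat2Z.inj_mul.
      match type of P with (_ | ?l) => match goal with |- (_ | ?r) =>
        replace r with l by ring end end. exact P. }
  assert (N : forall a, (1 < a)%nat -> exists x y, pell_graph a k x y).
  { intros a Ha. destruct (pell_pos (Z.of_nat a) k ltac:(lia)) as [Px Py].
    destruct (Z_of_nat_complete (px (Z.of_nat a) k)) as [x Ex]; [lia|].
    destruct (Z_of_nat_complete (py (Z.of_nat a) k)) as [y Ey]; [lia|].
    exists x, y. split; symmetry; assumption. }
  split.
  - intros ->. destruct (N (n + 3)%nat ltac:(lia)) as (c & c' & Hc).
    destruct (N (c + n + 3)%nat ltac:(lia)) as (x & y & Hxy).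
    assert (exists T, T + n * n + 1 = 2 * (c + n + 3) * n)%nat as [T ET].
    { exists (2 * (c + n + 3) * n - n * n - 1)%nat. nia. }
    destruct (G c c' x y T Hc ET Hxy) as [L D].
    exists c, c', x, y, T. repeat split; try lia; try apply Hc; try apply Hxy.
    apply congr_iff. rewrite (Nat2Z.inj_add (_ * y)), Z.sub_add_distr. exact D.
  - intros (c & c' & x & y & T & [_ Hc] & ET & L1 & [_ Hxy] & D1).
    destruct (G c c' x y T Hc ET Hxy) as [L2 D2].
    apply congr_iff in D1. rewrite (Nat2Z.inj_add (_ * y)), Z.sub_add_distr in D1.
    pose proof (Z.divide_sub_r _ _ _ D1 D2) as [w Hw].
    (* Both m and n^k lie in [0, T). *)
    assert (w = 0) by nia. nia.
Qed.

Lemma dio_pow (f g : valuation -> nat) :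
  dio_fun f -> dio_fun g -> dio_fun (fun nu => f nu ^ g nu)%nat.
Proof.
  apply dio_op2.
  apply dio_iff with (R := fun nu => ((nu 1 = 0 /\ nu 2 = 0 /\ nu 0 = 1) \/
    (nu 1 = 0 /\ 0 < nu 2 /\ nu 0 = 0) \/
    (0 < nu 1 /\ pow_system (nu 1) (nu 2) (nu 0)))%nat).
  - intro nu. destruct (Nat.eq_dec (nu 1%nat) 0) as [E|E].
    + rewrite E. destruct (nu 2%nat) as [|k]; simpl; lia.
    + rewrite pow_graph_iff by lia. intuition lia.
  - unfold pow_system. dio.
Defined.

(** * Binomial coefficients and binary masks *)

Local Open Scope nat_scope.

#[local] Hint Extern 0 (dio_fun (fun _ => _ ^ _)) => apply dio_pow : dio.

Fixpoint binom (n k : nat) : nat :=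
  match n, k with
  | _, 0 => 1
  | 0, S _ => 0
  | S n, S k => binom n k + binom n (S k)
  end.

Lemma binom_0_r (n : nat) : binom n 0 = 1.
Proof. destruct n; reflexivity. Qed.

Lemma binom_gt (n : nat) : forall k, n < k -> binom n k = 0.
Proof.
  induction n as [|n IH]; intros [|k] L; simpl; try lia.
  rewrite !IH by lia. reflexivity.
Qed.

Lemma binom_le_pow (n : nat) : forall k, binom n k <= 2 ^ n.
Proof.
  induction n as [|n IH]; intros [|k]; simpl; try lia.
  - pose proof (Nat.pow_nonzero 2 n ltac:(lia)). lia.
  - pose proof (IH k). pose proof (IH (S k)). lia.
Qed.

(** Truncated expansion of (1 + z)^n; for z > 2^n it is formed by the k lowest digits in base z. *)
Fixpoint binom_sum (z n k : nat) : nat :=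
  match k with
  | 0 => 0
  | S k => binom_sum z n k + binom n k * z ^ k
  end.

Lemma binom_sum_S (z n k : nat) :
  binom_sum z (S n) (S k) = binom_sum z n (S k) + z * binom_sum z n k.
Proof.
  induction k as [|k IH].
  - simpl. rewrite binom_0_r. lia.
  - change (binom_sum z (S n) (S (S k))) with
      (binom_sum z (S n) (S k) + (binom n k + binom n (S k)) * z ^ S k).
    rewrite IH. simpl. ring.
Qed.

(** Terms beyond index n vanish; the slack [j] serves the induction, where Pascal's rule involves
    two lengths. *)
Lemma binom_sum_total (z n : nat) : forall j, binom_sum z n (n + 1 + j) = (1 + z) ^ n.
Proof.
  induction n as [|n IH]; intro j.
  - induction j as [|j IHj]; [reflexivity|].
    replace (0 + 1 + S j) with (S (0 + 1 + j)) by lia. simpl.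
    simpl in IHj. rewrite IHj. lia.
  - replace (S n + 1 + j) with (S (n + 1 + j)) by lia.
    rewrite binom_sum_S, IH.
    replace (S (n + 1 + j)) with (n + 1 + S j) by lia. rewrite IH. simpl. ring.
Qed.

Lemma binom_sum_lt (z n k : nat) : 2 ^ n < z -> binom_sum z n k < z ^ k.
Proof.
  intro L. induction k as [|k IH]; simpl; [lia|].
  pose proof (binom_le_pow n k). nia.
Qed.

Lemma binom_sum_add (z n k j : nat) :
  exists h, binom_sum z n (k + j) = binom_sum z n k + z ^ k * h.
Proof.
  induction j as [|j [h IH]].
  - exists 0. rewrite Nat.add_0_r. lia.
  - exists (h + binom n (k + j) * z ^ j). rewrite Nat.add_succ_r. simpl.
    rewrite IH, Nat.pow_add_r. ring.
Qed.

(** Coefficients are at most 2^n < z, hence digits; l and h collect the lower and higher ones, and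
    division with remainder is unique. *)
Lemma binom_digit (n k c z : nat) : z = 2 ^ (n + 1) ->
  c = binom n k <->
  exists l h, (1 + z) ^ n = l + z ^ k * (c + z * h) /\ l < z ^ k /\ c < z.
Proof.
  intro Ez.
  assert (Lz : 2 ^ n < z).
  { rewrite Ez, Nat.add_1_r. simpl. pose proof (Nat.pow_nonzero 2 n ltac:(lia)). lia. }
  assert (E : exists h, (1 + z) ^ n = binom_sum z n k + z ^ k * (binom n k + z * h)).
  { destruct (binom_sum_add z n (S k) (n + 1)) as [h H].
    replace (S k + (n + 1)) with (n + 1 + S k) in H by lia.
    rewrite binom_sum_total in H. exists h. rewrite H. simpl. ring. }
  pose proof (binom_sum_lt z n k Lz) as L. pose proof (binom_le_pow n k) as Lb.
  destruct E as [h E]. split.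
  - intros ->. exists (binom_sum z n k), h. split; [exact E|split; [exact L|lia]].
  - intros (l & h' & E' & L1 & L2). rewrite E in E'.
    rewrite !(Nat.add_comm _ (z ^ k * _)) in E'.
    apply Nat.div_mod_unique in E' as [E' _]; try assumption.
    rewrite !(Nat.add_comm _ (z * _)) in E'.
    apply Nat.div_mod_unique in E' as [_ E']; try assumption; lia.
Qed.

(* By Lucas' theorem: every binary digit of [a] is at most that of [b]. *)
Definition submask (a b : nat) : Prop := Nat.odd (binom b a) = true.

Lemma submask_iff (a b : nat) :
  submask a b <-> exists z c l h, z = 2 ^ (b + 1) /\
    (1 + z) ^ b = l + z ^ a * (2 * c + 1 + z * h) /\ l < z ^ a /\ 2 * c + 1 < z.
Proof.
  unfold submask. rewrite Nat.odd_spec. split.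
  - intros [c Hc]. symmetry in Hc.
    apply (binom_digit b a _ _ eq_refl) in Hc as (l & h & H).
    exists (2 ^ (b + 1)), c, l, h. auto.
  - intros (z & c & l & h & Ez & H). exists c. symmetry.
    apply (binom_digit b a _ z Ez). exists l, h. exact H.
Qed.

Lemma dio_submask (f g : valuation -> nat) :
  dio_fun f -> dio_fun g -> dio_rel (fun nu => submask (f nu) (g nu)).
Proof.
  intros Df Dg.
  eapply dio_iff; [intro nu; apply submask_iff|]. dio.
Defined.

#[local] Hint Extern 0 (dio_rel (fun _ => submask _ _)) => apply dio_submask : dio.

(** Lucas' theorem modulo 2 for the last bit. By Pascal's rule, even rows give the following odd
    rows ([O]), and these the next even rows. *)
Lemma binom_double (n : nat) : forall k,
  Nat.odd (binom (2 * n) (2 * k)) = Nat.odd (binom n k) /\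
  Nat.odd (binom (2 * n) (2 * k + 1)) = false /\
  Nat.odd (binom (2 * n + 1) (2 * k)) = Nat.odd (binom n k) /\
  Nat.odd (binom (2 * n + 1) (2 * k + 1)) = Nat.odd (binom n k).
Proof.
  assert (R : forall a b, Nat.odd (binom (S a) (S b)) =
    xorb (Nat.odd (binom a b)) (Nat.odd (binom a (S b)))).
  { intros a b. simpl. apply Nat.odd_add. }
  assert (O : forall m, (forall k,
    Nat.odd (binom (2 * m) (2 * k)) = Nat.odd (binom m k) /\
    Nat.odd (binom (2 * m) (2 * k + 1)) = false) -> forall k,
    Nat.odd (binom (2 * m + 1) (2 * k)) = Nat.odd (binom m k) /\
    Nat.odd (binom (2 * m + 1) (2 * k + 1)) = Nat.odd (binom m k)).
  { intros m H k. rewrite !Nat.add_1_r, R. split.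
    - destruct k as [|k]; [rewrite !binom_0_r; reflexivity|].
      replace (2 * S k) with (S (2 * k + 1)) by lia. rewrite R.
      replace (S (2 * k + 1)) with (2 * S k) by lia.
      destruct (H k) as [_ ->]. destruct (H (S k)) as [-> _]. reflexivity.
    - destruct (H k) as [H1 H2]. rewrite Nat.add_1_r in H2. rewrite H1, H2.
      apply Bool.xorb_false_r. }
  induction n as [|n IH].
  - assert (H : forall k, Nat.odd (binom (2 * 0) (2 * k)) = Nat.odd (binom 0 k) /\
      Nat.odd (binom (2 * 0) (2 * k + 1)) = false).
    { intros [|k]; split; reflexivity. }
    intro k. destruct (H k), (O 0 H k). auto.
  - assert (H : forall k, Nat.odd (binom (2 * S n) (2 * k)) = Nat.odd (binom (S n) k) /\
      Nat.odd (binom (2 * S n) (2 * k + 1)) = false).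
    { intro k. replace (2 * S n) with (S (2 * n + 1)) by lia. split.
      - destruct k as [|k]; [rewrite !binom_0_r; reflexivity|].
        replace (2 * S k) with (S (2 * k + 1)) by lia. rewrite !R.
        replace (S (2 * k + 1)) with (2 * S k) by lia.
        destruct (IH k) as (_ & _ & _ & ->). destruct (IH (S k)) as (_ & _ & -> & _).
        reflexivity.
      - rewrite (Nat.add_1_r (2 * k)), R, <- (Nat.add_1_r (2 * k)).
        destruct (IH k) as (_ & _ & -> & ->). apply Bool.xorb_nilpotent. }
    intro k. destruct (H k), (O (S n) H k). auto.
Qed.

Lemma submask_double (a b i j : nat) : i < 2 -> j < 2 ->
  submask (2 * a + i) (2 * b + j) <-> submask a b /\ submask i j.
Proof.
  intros Hi Hj. unfold submask. destruct (binom_double b a) as (E00 & E10 & E01 & E11).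
  assert (i = 0 \/ i = 1) as [-> | ->] by lia;
  assert (j = 0 \/ j = 1) as [-> | ->] by lia;
    rewrite ?Nat.add_0_r, ?E00, ?E10, ?E01, ?E11; simpl; intuition congruence.
Qed.

Lemma submask_le (a b : nat) : submask a b -> a <= b.
Proof.
  unfold submask. intro H. apply Nat.nlt_ge. intro L.
  rewrite binom_gt in H by exact L. discriminate.
Qed.

Lemma half_bit (n : nat) : exists m i, n = 2 * m + i /\ i < 2.
Proof.
  exists (n / 2), (n mod 2). split; [apply Nat.div_mod_eq|].
  apply Nat.mod_upper_bound. lia.
Qed.

(** Bits are compared independently, so blocks of bits are too; peel them off by
    [submask_double]. *)
Lemma submask_block (k : nat) : forall a b a' b', a < 2 ^ k -> b < 2 ^ k ->
  submask (a + 2 ^ k * a') (b + 2 ^ k * b') <-> submask a b /\ submask a' b'.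
Proof.
  induction k as [|k IH]; intros a b a' b' La Lb.
  - simpl in *. replace a with 0 by lia. replace b with 0 by lia.
    simpl. rewrite !Nat.add_0_r. unfold submask at 2. simpl. tauto.
  - destruct (half_bit a) as (a1 & i & -> & Li).
    destruct (half_bit b) as (b1 & j & -> & Lj). simpl in La, Lb.
    replace (2 * a1 + i + 2 ^ S k * a') with (2 * (a1 + 2 ^ k * a') + i)
      by (simpl; ring).
    replace (2 * b1 + j + 2 ^ S k * b') with (2 * (b1 + 2 ^ k * b') + j)
      by (simpl; ring).
    rewrite !submask_double by assumption. rewrite IH by lia. tauto.
Qed.

(** All [w] bits of [v] are 1, so no bit of [u] below position [w] is constrained. *)
Lemma submask_ones (w : nat) : forall u v, v + 1 = 2 ^ w ->
  submask u v <-> u < 2 ^ w.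
Proof.
  induction w as [|w IH]; intros u v E.
  - simpl in *. replace v with 0 by lia. split.
    + intro H. apply submask_le in H. lia.
    + intro L. replace u with 0 by lia. reflexivity.
  - destruct (half_bit u) as (u1 & i & -> & Li). simpl in E.
    replace v with (2 * (2 ^ w - 1) + 1) by lia.
    rewrite submask_double by lia. rewrite IH by lia. simpl. split; [lia|].
    intro L. split; [lia|]. assert (i = 0 \/ i = 1) as [-> | ->] by lia; reflexivity.
Qed.

(** * Reachability under affine rules *)

Definition affine_rule : Set := nat * nat * (nat * nat).

Definition affine_step (rs : list affine_rule) (x y : nat) : Prop :=
  exists a b c d u, In ((a, b), (c, d)) rs /\ x = a * u + b /\ y = c * u + d.

(* Numbers are read as digit sequences in a base [2^k > v]; digit [i] of [E] is 1
   if a step takes place at time [i].  For each rule, the digits of [M] mark the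
   times at which the rule is used and those of [U] are its parameters at these
   times; then [X] and [Y] list the sources and targets of the steps, and [S]
   counts the rules used at each time. *)
Fixpoint traces (rs : list affine_rule) (v E S X Y : nat) : Prop :=
  match rs with
  | [] => S = 0 /\ X = 0 /\ Y = 0
  | ((a, b), (c, d)) :: rs =>
      exists M U S' X' Y', submask M E /\ submask U (M * v) /\
        traces rs v E S' X' Y' /\
        S = M + S' /\ X = a * U + b * M + X' /\ Y = c * U + d * M + Y'
  end.

Lemma dio_traces (rs : list affine_rule) : forall fv fE fS fX fY,
  dio_fun fv -> dio_fun fE -> dio_fun fS -> dio_fun fX -> dio_fun fY ->
  dio_rel (fun nu => traces rs (fv nu) (fE nu) (fS nu) (fX nu) (fY nu)).
Proof.
  induction rs as [|[[a b] [c d]] rs IH]; intros fv fE fS fX fY Dv DE DS DX DY; simpl.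
  - dio.
  - do 5 (apply dio_ex; unfold val_shift; cbv beta).
    repeat apply dio_conj; try apply IH; dio.
Defined.

#[local] Hint Extern 0 (dio_rel (fun _ => traces _ _ _ _ _ _)) =>
  apply dio_traces : dio.

Lemma submask_block_iff (k n b b' : nat) : b < 2 ^ k ->
  submask n (b + 2 ^ k * b') <->
  exists a a', n = a + 2 ^ k * a' /\ submask a b /\ submask a' b'.
Proof.
  intro Lb. split.
  - intro H. rewrite (Nat.div_mod_eq n (2 ^ k)), Nat.add_comm in H.
    pose proof (Nat.mod_upper_bound n (2 ^ k)
      (Nat.pow_nonzero 2 k ltac:(lia))) as L.
    apply submask_block in H as [H H']; [|assumption..].
    exists (n mod 2 ^ k), (n / 2 ^ k). split; [|auto].
    rewrite Nat.add_comm. apply Nat.div_mod_eq.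
  - intros (a & a' & -> & H & H').
    apply submask_le in H as La. apply submask_block; auto. lia.
Qed.

(** Masks split into blocks and the equations are linear, so the lowest position separates. The sums
    s, x, y may still exceed the base here. *)
Lemma traces_block (k v : nat) : 1 < 2 ^ k -> v < 2 ^ k ->
  forall rs e E S X Y, e <= 1 ->
  traces rs v (e + 2 ^ k * E) S X Y <->
  exists s x y S' X' Y', traces rs v e s x y /\ traces rs v E S' X' Y' /\
    S = s + 2 ^ k * S' /\ X = x + 2 ^ k * X' /\ Y = y + 2 ^ k * Y'.
Proof.
  intros Lk Lv rs e E.
  induction rs as [|[[a b] [c d]] rs IH]; intros S X Y Le; simpl.
  - split.
    + intros (-> & -> & ->). exists 0, 0, 0, 0, 0, 0. lia.
    + intros (s & x & y & S' & X' & Y' & (-> & -> & ->) & (-> & -> & ->) & -> & -> & ->). lia.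
  - split.
    + intros (M & U & S1 & X1 & Y1 & HM & HU & H & -> & -> & ->).
      apply submask_block_iff in HM as (m & M' & -> & Hm & HM'); [|lia].
      pose proof (submask_le _ _ Hm).
      replace ((m + 2 ^ k * M') * v) with (m * v + 2 ^ k * (M' * v)) in HU by ring.
      apply submask_block_iff in HU as (u & U' & -> & Hu & HU'); [|nia].
      apply IH in H as (s & x & y & S2 & X2 & Y2 & H1 & H2 & -> & -> & ->); [|exact Le].
      exists (m + s), (a * u + b * m + x), (c * u + d * m + y),
        (M' + S2), (a * U' + b * M' + X2), (c * U' + d * M' + Y2).
      split; [exists m, u, s, x, y; auto 10|].
      split; [exists M', U', S2, X2, Y2; auto 10|].
      repeat split; ring.
    + intros (s & x & y & S' & X' & Y' &
        (m & u & s1 & x1 & y1 & Hm & Hu & H1 & -> & -> & ->) &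
        (M & U & S1 & X1 & Y1 & HM & HU & H2 & -> & -> & ->) & -> & -> & ->).
      pose proof (submask_le _ _ Hm).
      exists (m + 2 ^ k * M), (u + 2 ^ k * U), (s1 + 2 ^ k * S1),
        (x1 + 2 ^ k * X1), (y1 + 2 ^ k * Y1).
      split; [apply submask_block_iff; [lia|eauto]|].
      split.
      { replace ((m + 2 ^ k * M) * v) with (m * v + 2 ^ k * (M * v)) by ring.
        apply submask_block_iff; [nia|eauto]. }
      split; [apply IH; [exact Le|]; exists s1, x1, y1, S1, X1, Y1; auto|].
      repeat split; ring.
Qed.

Lemma submask_0_l (n : nat) : submask 0 n.
Proof. unfold submask. rewrite binom_0_r. reflexivity. Qed.

Lemma traces_none (v E : nat) (rs : list affine_rule) : traces rs v E 0 0 0.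
Proof.
  induction rs as [|[[a b] [c d]] rs IH]; simpl; [auto|].
  exists 0, 0, 0, 0, 0. repeat split; auto using submask_0_l; lia.
Qed.

Lemma traces_none_inv (v E : nat) (rs : list affine_rule) : forall X Y,
  traces rs v E 0 X Y -> X = 0 /\ Y = 0.
Proof.
  induction rs as [|[[a b] [c d]] rs IH]; simpl; intros X Y; [tauto|].
  intros (M & U & S' & X' & Y' & HM & HU & H & E0 & -> & ->).
  assert (M = 0) as -> by lia. assert (S' = 0) as -> by lia.
  apply submask_le in HU. apply IH in H. nia.
Qed.

(** Measures how large the sums at one time can get, and so how large the base must be; the 1
    accounts for the mark of the rule. *)
Fixpoint rules_weight (rs : list affine_rule) : nat :=
  match rs with
  | [] => 0
  | ((a, b), (c, d)) :: rs => 1 + a + b + c + d + rules_weight rs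
  end.

Lemma traces_bound (v : nat) (rs : list affine_rule) : forall S X Y,
  traces rs v 1 S X Y -> S <= rules_weight rs /\
    X <= rules_weight rs * (v + 1) /\ Y <= rules_weight rs * (v + 1).
Proof.
  induction rs as [|[[a b] [c d]] rs IH]; simpl; intros S X Y; [lia|].
  intros (M & U & S' & X' & Y' & HM & HU & H & -> & -> & ->).
  apply IH in H as (L1 & L2 & L3). apply submask_le in HM, HU.
  assert (U <= v) by nia.
  assert (forall p q, p * U + q * M <= (p + q) * (v + 1)) as B by (intros; nia).
  pose proof (B a b). pose proof (B c d). nia.
Qed.

(** Total 1 means that a single rule has M = 1; for the others M = 0 forces U = 0 by the mask
    [M * v]. *)
Lemma traces_step (v : nat) (rs : list affine_rule) : forall X Y,
  traces rs v 1 1 X Y -> affine_step rs X Y.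
Proof.
  unfold affine_step.
  induction rs as [|[[a b] [c d]] rs IH]; simpl; intros X Y; [lia|].
  intros (M & U & S' & X' & Y' & HM & HU & H & E & -> & ->).
  assert (M = 1 /\ S' = 0 \/ M = 0 /\ S' = 1) as [[-> ->]|[-> ->]] by lia.
  - apply traces_none_inv in H as [-> ->].
    exists a, b, c, d, U. split; [auto|lia].
  - apply submask_le in HU. apply IH in H as (a' & b' & c' & d' & u & HIn & -> & ->).
    exists a', b', c', d', u. split; [auto|nia].
Qed.

Lemma step_traces (a b c d u v w : nat) (rs : list affine_rule) :
  v + 1 = 2 ^ w -> u <= v -> In ((a, b), (c, d)) rs ->
  traces rs v 1 1 (a * u + b) (c * u + d).
Proof.
  intros Ev Lu. induction rs as [|[[a' b'] [c' d']] rs IH]; simpl; [tauto|].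
  intros [E|HIn].
  - injection E as -> -> -> ->. exists 1, u, 0, 0, 0.
    rewrite Nat.mul_1_l. repeat split; try lia; auto using traces_none.
    apply (submask_ones w); lia.
  - exists 0, 0, 1, (a * u + b), (c * u + d).
    repeat split; auto using submask_0_l; lia.
Qed.

(** 1 + B + ... + B^(t-1); as both [E] and [S] of [traces] it demands exactly one rule at each of t
    times. *)
Fixpoint repunit (B t : nat) : nat :=
  match t with
  | 0 => 0
  | S t => 1 + B * repunit B t
  end.

(** Geometric sum; for B > 1 this equation determines the repunit, and [affine_reach] uses it for
    that. *)
Lemma repunit_spec (B t : nat) : repunit B t * B + 1 = B ^ t + repunit B t.
Proof. induction t as [|t IH]; simpl; nia. Qed.

Lemma digit_unique (B x y X Y : nat) : x < B -> y < B ->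
  x + B * X = y + B * Y -> x = y /\ X = Y.
Proof.
  intros Lx Ly E. rewrite !(Nat.add_comm _ (B * _)) in E.
  apply Nat.div_mod_unique in E; tauto.
Qed.

(** The equation shifts the targets [Y] by one digit against the sources [X]: each target is the
    next source, from [s] to the final [x]. Induction peels off the lowest digit. *)
Lemma traces_sound (rs : list affine_rule) (v k : nat) :
  1 < 2 ^ k -> v < 2 ^ k -> rules_weight rs * (v + 1) < 2 ^ k ->
  forall t s x X Y, s < 2 ^ k ->
  traces rs v (repunit (2 ^ k) t) (repunit (2 ^ k) t) X Y ->
  s + 2 ^ k * Y = X + (2 ^ k) ^ t * x ->
  clos_refl_trans nat (affine_step rs) s x.
Proof.
  intros Lk Lv LK. set (B := 2 ^ k) in *.
  induction t as [|t IH]; intros s x X Y Ls H E; simpl in H, E.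
  - apply traces_none_inv in H as [-> ->].
    replace x with s by lia. apply rt_refl.
  - apply (traces_block k v Lk Lv rs 1 (repunit B t)) in H
      as (s0 & x0 & y0 & S' & X' & Y' & H0 & H' & ES & -> & ->); [|lia].
    (* The weight bound keeps these sums below [B]: no carries occur and digits can be compared. *)
    fold B in ES, E. destruct (traces_bound _ _ _ _ _ H0) as (L1 & L2 & L3).
    assert (s0 < B) by nia.
    apply (digit_unique B 1 s0) in ES as [<- <-]; [|lia|lia].
    destruct (digit_unique B s x0 (y0 + B * Y') (X' + B ^ t * x)) as [-> E'];
      [lia|lia|nia|].
    apply rt_trans with y0.
    + apply rt_step, (traces_step v), H0.
    + apply (IH y0 x X' Y'); [lia|exact H'|exact E'].
Qed.

(** [v0] is the sum of the parameters along the run; any larger [v] works, so it can be chosen of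
    the form 2^w - 1, and [k] after it. *)
Lemma traces_complete (rs : list affine_rule) (s x : nat) :
  clos_refl_trans nat (affine_step rs) s x ->
  exists v0, forall v w k, v0 <= v -> v + 1 = 2 ^ w -> v < 2 ^ k -> 1 < 2 ^ k ->
  exists t X Y, traces rs v (repunit (2 ^ k) t) (repunit (2 ^ k) t) X Y /\
    s + 2 ^ k * Y = X + (2 ^ k) ^ t * x.
Proof.
  intro H. apply clos_rt_rt1n in H.
  induction H as [s|s y x (a & b & c & d & u & HIn & -> & ->) H (v0 & IH)].
  - exists 0. intros v w k _ _ _ _. exists 0, 0, 0. simpl.
    split; [apply traces_none|lia].
  - exists (v0 + u). intros v w k L Ew Lv Lk.
    destruct (IH v w k) as (t & X & Y & HT & E); try assumption; try lia.
    exists (S t), (a * u + b + 2 ^ k * X), (c * u + d + 2 ^ k * Y). split.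
    + simpl repunit. apply (traces_block k v Lk Lv rs 1); [lia|].
      exists 1, (a * u + b), (c * u + d), (repunit (2 ^ k) t), X, Y.
      repeat split; try assumption; try lia.
      apply (step_traces a b c d u v w); auto; lia.
    + simpl. set (B := 2 ^ k) in *. nia.
Qed.

Definition affine_reach (rs : list affine_rule) (s x : nat) : Prop :=
  exists w v k B t T E X Y,
    v + 1 = 2 ^ w /\ B = 2 ^ k /\ T = B ^ t /\ E * B + 1 = T + E /\
    1 < B /\ v < B /\ rules_weight rs * (v + 1) < B /\ s < B /\
    traces rs v E E X Y /\ s + B * Y = X + T * x.

Lemma affine_reach_iff (rs : list affine_rule) (s x : nat) :
  clos_refl_trans nat (affine_step rs) s x <-> affine_reach rs s x.
Proof.
  split.
  - intro H. apply traces_complete in H as [v0 H].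
    pose proof (Nat.pow_gt_lin_r 2 v0 ltac:(lia)) as L0.
    (* 2^v0 - 1 is at least v0, and 2^k > k exceeds every quantity summed into k. *)
    set (v := 2 ^ v0 - 1).
    set (k := 1 + v + rules_weight rs * (v + 1) + s).
    pose proof (Nat.pow_gt_lin_r 2 k ltac:(lia)) as Lk.
    destruct (H v v0 k) as (t & X & Y & HT & E); try lia.
    exists v0, v, k, (2 ^ k), t, ((2 ^ k) ^ t), (repunit (2 ^ k) t), X, Y.
    repeat split; try assumption; try apply repunit_spec; try lia.
  - intros (w & v & k & B & t & T & E & X & Y & Ev & -> & -> & EE & L1 & L2 & L3 & L4 & H & EQ).
    assert (E = repunit (2 ^ k) t) as ->.
    { pose proof (repunit_spec (2 ^ k) t). nia. }
    apply (traces_sound rs v k L1 L2 L3 t s x X Y L4 H EQ).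
Qed.

Lemma dio_affine_reach (rs : list affine_rule) (f g : valuation -> nat) :
  dio_fun f -> dio_fun g ->
  dio_rel (fun nu => clos_refl_trans nat (affine_step rs) (f nu) (g nu)).
Proof.
  intros Df Dg. eapply dio_iff; [intro nu; apply affine_reach_iff|].
  unfold affine_reach. dio.
Defined.

#[local] Hint Extern 0 (dio_rel (fun _ => clos_refl_trans nat (affine_step _) _ _)) =>
  apply dio_affine_reach : dio.

(** * FRACTRAN steps as affine rules *)

Definition affine_rel (R : nat -> nat -> Prop) : Set :=
  {rs : list affine_rule | forall x y, R x y <-> affine_step rs x y}.

Lemma affine_iff (R T : nat -> nat -> Prop) :
  (forall x y, T x y <-> R x y) -> affine_rel R -> affine_rel T.
Proof. intros E [rs H]. exists rs. intros x y. rewrite E. apply H. Defined.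

Lemma affine_empty : affine_rel (fun _ _ => False).
Proof.
  exists []. intros x y. split; [tauto|]. intros (a & b & c & d & u & [] & _).
Defined.

Lemma affine_line (a b c d : nat) :
  affine_rel (fun x y => exists u, x = a * u + b /\ y = c * u + d).
Proof.
  exists [((a, b), (c, d))]. intros x y. split.
  - intros [u H]. exists a, b, c, d, u. simpl. auto.
  - intros (a' & b' & c' & d' & u & [E|[]] & H).
    injection E as -> -> -> ->. exists u. exact H.
Defined.

Lemma affine_union (R T : nat -> nat -> Prop) :
  affine_rel R -> affine_rel T -> affine_rel (fun x y => R x y \/ T x y).
Proof.
  intros [rs H] [rs' H']. exists (rs ++ rs'). intros x y. rewrite H, H'.
  unfold affine_step. split.
  - intros [(a & b & c & d & u & HIn & E)|(a & b & c & d & u & HIn & E)];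
      exists a, b, c, d, u; rewrite in_app_iff; auto.
  - intros (a & b & c & d & u & HIn & E).
    apply in_app_iff in HIn as [HIn|HIn]; [left|right]; exists a, b, c, d, u; auto.
Defined.

Lemma affine_guard (P : Prop) (R : nat -> nat -> Prop) :
  {P} + {~ P} -> affine_rel R -> affine_rel (fun x y => P /\ R x y).
Proof.
  intros [HP|HP] HR.
  - apply (affine_iff R); [tauto|exact HR].
  - apply (affine_iff (fun _ _ => False)); [tauto|exact affine_empty].
Defined.

Lemma affine_bunion (R : nat -> nat -> nat -> Prop) (n : nat) :
  (forall r, affine_rel (R r)) ->
  affine_rel (fun x y => exists r, r < n /\ R r x y).
Proof.
  intro HR. induction n as [|n IH].
  - apply (affine_iff (fun _ _ => False)); [|exact affine_empty].
    intros x y. split; [intros (r & L & _); lia|tauto].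
  - apply (affine_iff (fun x y => R n x y \/ exists r, r < n /\ R r x y)).
    + intros x y. split.
      * intros (r & L & H). destruct (Nat.eq_dec r n) as [->|N]; [auto|].
        right. exists r. split; [lia|exact H].
      * intros [H|(r & L & H)]; [exists n|exists r]; auto.
    + apply affine_union; auto.
Defined.

(** Covers q = 0, where n mod 0 = n. *)
Lemma divide_dec (q n : nat) : {Nat.divide q n} + {~ Nat.divide q n}.
Proof.
  destruct (Nat.eq_dec (n mod q) 0) as [E|N].
  - left. now apply Nat.Lcm0.mod_divide.
  - right. intro H. now apply N, Nat.Lcm0.mod_divide.
Defined.

Lemma divide_add_mul_iff (q n m : nat) :
  Nat.divide q (q * m + n) <-> Nat.divide q n.
Proof.
  split; intro H.
  - apply (Nat.divide_add_cancel_r q (q * m)); [apply Nat.divide_factor_l|exact H].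
  - apply Nat.divide_add_r; [apply Nat.divide_factor_l|exact H].
Qed.

Lemma divide_0_l_iff (n : nat) : Nat.divide 0 n <-> n = 0.
Proof.
  split; [apply Nat.divide_0_l|]. intros ->. apply Nat.divide_0_r.
Qed.

(** For q > 0 write x = q u + r: then q divides p x exactly when it divides p r, and y = p u + p r /
    q. For q = 0, x must be 0 and y is free. *)
Lemma affine_fraction (p q : nat) : (p, q) <> (0, 0) ->
  affine_rel (fun x y => q * y = p * x).
Proof.
  intro N. destruct (Nat.eq_dec q 0) as [->|Nq].
  - apply (affine_iff (fun x y => exists u, x = 0 * u + 0 /\ y = 1 * u + 0)).
    + intros x y. assert (p <> 0) by congruence. split.
      * intro E. exists y. nia.
      * intros (u & -> & ->). lia.
    + apply affine_line.
  - apply (affine_iff (fun x y => exists r, r < q /\ Nat.divide q (p * r) /\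
      exists u, x = q * u + r /\ y = p * u + p * r / q)).
    + intros x y. split.
      * intro E. pose proof (Nat.div_mod_eq x q) as Ex.
        exists (x mod q). split; [apply Nat.mod_upper_bound; lia|].
        set (r := x mod q) in *. set (u := x / q) in *.
        assert (D : Nat.divide q (p * r)).
        { apply (divide_add_mul_iff q _ (p * u)). exists y. nia. }
        split; [exact D|]. exists u. split; [exact Ex|].
        destruct D as [z Hz]. rewrite Hz, Nat.div_mul by exact Nq.
        apply (Nat.mul_cancel_l _ _ q Nq). nia.
      * intros (r & _ & [z Hz] & u & -> & ->).
        rewrite Hz, Nat.div_mul by exact Nq. nia.
    + apply affine_bunion. intro r. apply affine_guard; [apply divide_dec|].
      apply affine_line.
Defined.

(** For q > 0 divisibility depends only on u mod q. For q = 0 the condition is x <> 0, decided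
    separately for u = 0 and u > 0. *)
Lemma affine_line_restrict (p q a b c d : nat) : (p, q) <> (0, 0) ->
  affine_rel (fun x y => ~ Nat.divide q (p * x) /\
    exists u, x = a * u + b /\ y = c * u + d).
Proof.
  intro N. destruct (Nat.eq_dec q 0) as [->|Nq].
  - assert (Np : p <> 0) by congruence.
    assert (D : forall x, ~ Nat.divide 0 (p * x) <-> x <> 0).
    { intro x. rewrite divide_0_l_iff. nia. }
    apply (affine_iff (fun x y =>
      (b <> 0 /\ exists u, x = 0 * u + b /\ y = 0 * u + d) \/
      (a + b <> 0 /\ exists u, x = a * u + (a + b) /\ y = c * u + (c + d)))).
    + intros x y. rewrite D. split.
      * intros (Nx & [|u] & -> & ->); [left|right]; (split; [lia|]);
          [exists 0|exists u]; lia.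
      * intros [(Nb & u & -> & ->)|(Nb & u & -> & ->)]; (split; [lia|]);
          [exists 0|exists (S u)]; lia.
    + apply affine_union; (apply affine_guard; [|apply affine_line]).
      * destruct (Nat.eq_dec b 0); [right|left]; lia.
      * destruct (Nat.eq_dec (a + b) 0); [right|left]; lia.
  - apply (affine_iff (fun x y => exists r, r < q /\
      ~ Nat.divide q (p * (a * r + b)) /\
      exists u, x = (a * q) * u + (a * r + b) /\ y = (c * q) * u + (c * r + d))).
    + assert (D : forall u r, Nat.divide q (p * (a * q * u + (a * r + b))) <->
        Nat.divide q (p * (a * r + b))).
      { intros u r. replace (p * (a * q * u + (a * r + b))) with
          (q * (p * a * u) + p * (a * r + b)) by ring. apply divide_add_mul_iff. }
      intros x y. split.
      * intros (Nx & u & -> & ->). exists (u mod q).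
        split; [apply Nat.mod_upper_bound; lia|].
        pose proof (Nat.div_mod_eq u q) as Eu.
        set (r := u mod q) in *. set (w := u / q) in *.
        replace (a * u + b) with (a * q * w + (a * r + b)) in * by (rewrite Eu; ring).
        rewrite D in Nx. split; [exact Nx|]. exists w. split; [reflexivity|].
        rewrite Eu. ring.
      * intros (r & _ & Nr & u & -> & ->). rewrite D. split; [exact Nr|].
        exists (q * u + r). split; ring.
    + apply affine_bunion. intro r. apply affine_guard; [|apply affine_line].
      destruct (divide_dec q (p * (a * r + b))); auto.
Defined.

Lemma affine_restrict (p q : nat) (R : nat -> nat -> Prop) : (p, q) <> (0, 0) ->
  affine_rel R -> affine_rel (fun x y => ~ Nat.divide q (p * x) /\ R x y).
Proof.
  intros N [rs HR].
  apply (affine_iff (fun x y => ~ Nat.divide q (p * x) /\ affine_step rs x y));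
    [intros; rewrite HR; tauto|]. clear R HR.
  induction rs as [|[[a b] [c d]] rs IH].
  - apply (affine_iff (fun _ _ => False)); [|exact affine_empty].
    intros x y. split; [|tauto]. intros (_ & a & b & c & d & u & [] & _).
  - apply (affine_iff (fun x y =>
      (~ Nat.divide q (p * x) /\ exists u, x = a * u + b /\ y = c * u + d) \/
      (~ Nat.divide q (p * x) /\ affine_step rs x y))).
    + intros x y. unfold affine_step. split.
      * intros (D & a' & b' & c' & d' & u & [E|HIn] & H).
        -- injection E as -> -> -> ->. left. eauto.
        -- right. split; [exact D|]. exists a', b', c', d', u. auto.
      * intros [(D & u & H)|(D & a' & b' & c' & d' & u & HIn & H)];
          (split; [exact D|]).
        -- exists a, b, c, d, u. simpl. auto.
        -- exists a', b', c', d', u. simpl. auto.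
    + apply affine_union; [now apply affine_line_restrict|exact IH].
Defined.

(** * FRACTRAN steps, stuck states and termination *)

Lemma fractran_step_nil (x y : nat) : ~ fractran_step [] x y.
Proof. intro H. inversion H. Qed.

Lemma fractran_step_cons (p q : nat) (Q : fractran_program) (x y : nat) :
  fractran_step ((p, q) :: Q) x y <->
  q * y = p * x \/ (~ Nat.divide q (p * x) /\ fractran_step Q x y).
Proof.
  split.
  - intro H. inversion H; subst; auto.
  - intros [E|[D H]]; [now apply fractran_step_head|now apply fractran_step_tail].
Qed.

Lemma affine_fractran_step (Q : fractran_program) : ~ In (0, 0) Q ->
  affine_rel (fractran_step Q).
Proof.
  induction Q as [|[p q] Q IH]; intro N.
  - apply (affine_iff (fun _ _ => False)); [|exact affine_empty].
    intros x y. split; [apply fractran_step_nil|tauto].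
  - eapply affine_iff; [apply fractran_step_cons|].
    assert ((p, q) <> (0, 0)) by (intro E; apply N; left; exact E).
    apply affine_union; [now apply affine_fraction|].
    apply affine_restrict; [assumption|]. apply IH. intro HIn. apply N. now right.
Defined.

Lemma fractran_stuck_cons (p q : nat) (Q : fractran_program) (x : nat) :
  ~ (exists y, fractran_step ((p, q) :: Q) x y) <->
  ~ Nat.divide q (p * x) /\ ~ (exists y, fractran_step Q x y).
Proof.
  split.
  - intro N. assert (D : ~ Nat.divide q (p * x)).
    { intros [y Hy]. apply N. exists y. apply fractran_step_head. lia. }
    split; [exact D|]. intros [y Hy]. apply N. exists y. now apply fractran_step_tail.
  - intros [D N] [y H]. apply fractran_step_cons in H as [E|[_ H]]; [|eauto].
    apply D. exists y. lia.
Qed.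

(** The remainder is written r + 1 to be positive; for q = 0 it has no upper bound. *)
Lemma not_divide_iff (q n : nat) : ~ Nat.divide q n <->
  exists u r, n = q * u + (r + 1) /\ (q = 0 \/ r + 1 < q).
Proof.
  split.
  - intro N. destruct (Nat.eq_dec q 0) as [->|Nq].
    + exists 0, (n - 1). rewrite divide_0_l_iff in N. lia.
    + pose proof (Nat.div_mod_eq n q). pose proof (Nat.mod_upper_bound n q Nq).
      assert (n mod q <> 0) by (intro E; now apply N, Nat.Lcm0.mod_divide).
      exists (n / q), (n mod q - 1). lia.
  - intros (u & r & -> & [-> |L]).
    + rewrite divide_0_l_iff. lia.
    + rewrite divide_add_mul_iff. intro D. apply Nat.divide_pos_le in D; lia.
Qed.

Lemma dio_fractran_stuck (Q : fractran_program) (g : valuation -> nat) :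
  dio_fun g -> dio_rel (fun nu => ~ exists y, fractran_step Q (g nu) y).
Proof.
  intro Dg. induction Q as [|[p q] Q IH].
  (* The empty program is stuck everywhere; [0 = 0] expresses truth. *)
  - apply (dio_iff (fun _ => 0 = 0)); [|dio].
    intro nu. split; [reflexivity|]. intros _ [y H]. exact (fractran_step_nil _ _ H).
  - eapply dio_iff; [intro nu; apply fractran_stuck_cons|].
    apply dio_conj; [|exact IH].
    eapply dio_iff; [intro nu; apply not_divide_iff|]. dio.
Defined.

(** Either an earlier fraction applies, or 0/0 is reached and its equation 0 = 0 allows any y. *)
Lemma fractran_zero_zero_step (Q : fractran_program) (x : nat) :
  In (0, 0) Q -> exists y, fractran_step Q x y.
Proof.
  induction Q as [|[p q] Q IH]; [intros []|]. intros [E|HIn].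
  - injection E as -> ->. exists 0. now apply fractran_step_head.
  - destruct (divide_dec q (p * x)) as [[y Hy]|D].
    + exists y. apply fractran_step_head. lia.
    + destruct (IH HIn) as [y Hy]. exists y. now apply fractran_step_tail.
Qed.

Lemma clos_refl_trans_iff (R T : nat -> nat -> Prop) (s x : nat) :
  (forall x y, R x y <-> T x y) ->
  clos_refl_trans nat R s x <-> clos_refl_trans nat T s x.
Proof.
  intro E. split; intro H; induction H as [s x H| |];
    eauto using rt_refl, rt_trans; apply rt_step, E, H.
Qed.

Theorem theorem7p3 (Q : fractran_program) (f : valuation -> nat) :
  dio_fun f -> dio_rel (fun nu => fractran_terminates Q (f nu)).
Proof.
  intro Df.
  (* The witness is informative, so the case distinction has to be decidable. *)
  destruct (in_dec (fun u v : nat * nat => ltac:(repeat decide equality)) (0, 0) Q) as [HIn|N].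
  (* No state is stuck, so termination is the false relation, expressed by [0 = 1]. *)
  - apply (dio_iff (fun _ => 0 = 1)); [|dio].
    intro nu. split; [|discriminate]. intros (x & _ & H).
    destruct (H (fractran_zero_zero_step Q x HIn)).
  - destruct (affine_fractran_step Q N) as [rs Hrs].
    apply (dio_iff (fun nu => exists x,
      clos_refl_trans nat (affine_step rs) (f nu) x /\
      ~ exists y, fractran_step Q x y)).
    + intro nu. unfold fractran_terminates.
      split; intros (x & H & Hx); exists x;
        (split; [now apply (clos_refl_trans_iff _ _ _ _ Hrs)|exact Hx]).
    + apply dio_ex, dio_conj; [unfold val_shift; dio|].
      apply dio_fractran_stuck. dio.
Qed.
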